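(* Let $\Gamma$ be a balanced signed graph on $n$ vertices, let $\overline{\Gamma}$ be its signed complement, and let $1\le k\le n-1$. Let $L_k=L(F_k(\Gamma))$ and $\overline{L}_k=L(F_k(\overline{\Gamma}))$ be the (signed) Laplacian matrices of their $k$-token signed graphs. (i) The matrices commute: $L_k\overline{L}_k=\overline{L}_kL_k$. (ii) Every Laplacian eigenvalue $\lambda_J$ of the (unsigned) Johnson graph $J(n,k)=F_k(K_n)$ is the sum of one Laplacian eigenvalue of $F_k(\Gamma)$ and one Laplacian eigenvalue of $F_k(\overline{\Gamma})$, where each eigenvalue of $F_k(\Gamma)$ and each eigenvalue of $F_k(\overline{\Gamma})$ is used once. That is, with $N=\binom nk$, one can list, with multiplicities, the Laplacian eigenvalues of $F_k(\Gamma)$, $F_k(\overline{\Gamma})$ and $J(n,k)$ as $(\alpha_i)_{i=1}^N$, $(\beta_i)_{i=1}^N$ and $(\gamma_i)_{i=1}^N$, respectively, so that $\alpha_i+\beta_i=\gamma_i$ for all $i$.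
   Context: All graphs are finite and simple. A signed graph $\Gamma=(G,\sigma)$ is a graph $G=(V,E)$ with a signature $\sigma:E\to\{+1,-1\}$. It is balanced if every cycle of $G$ has positive sign, the sign of a cycle being the product of the signs of its edges. The (signed) adjacency matrix of $\Gamma$ has $(u,v)$ entry $\sigma(uv)$ if $uv\in E$ and $0$ otherwise; the Laplacian matrix $L(\Gamma)$ is the diagonal matrix of vertex degrees in $G$ minus the adjacency matrix. An unsigned graph is regarded as a signed graph with all signs $+1$. Signed complement: if $\Gamma=(G,\sigma)$ is balanced, there is a diagonal matrix $S$ with diagonal entries $\pm1$ such that the signed adjacency matrix of $\Gamma$ is $SAS$, where $A$ is the (unsigned) adjacency matrix of $G$. Fix such an $S$. The signed complement $\overline{\Gamma}$ is the signed graph on the complement graph $\overline{G}$ with adjacency matrix $S\overline{A}S$ and Laplacian matrix $S\overline{L}S$, where $\overline{A}$ and $\overline{L}$ are the (unsigned) adjacency and Laplacian matrices of $\overline{G}$. The $k$-token signed graph $F_k(\Gamma)$ has as vertices the $k$-element subsets of $V$; two vertices $A,B$ are adjacent iff $A\,\Delta\, B=\{a,b\}$ with $a\in A$, $b\in B$, $ab\in E$, and the edge $AB$ then has sign $\sigma(ab)$. Both $L_k$ and $\overline{L}_k$ are indexed by the $k$-subsets of $V$. *)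

(* Defs.v *)
From mathcomp Require Import all_boot all_order all_algebra.
From mathcomp Require Import zify.
Set Implicit Arguments. Unset Strict Implicit. Unset Printing Implicit Defensive.
Import Order.TTheory GRing.Theory Num.Theory.
Local Open Scope ring_scope.

Record graph (V : finType) := Graph {
  edge : rel V;
  edge_sym : symmetric edge;
  edge_irr : irreflexive edge }.

(* An edge uv is negative when [neg u v]; the values of [neg] outside the edge
   set are irrelevant. *)
Record sgraph (V : finType) := SGraph {
  underlying :> graph V;
  neg : V -> V -> bool;
  neg_sym : forall u v, neg u v = neg v u }.

Section Graphs.
Variable V : finType.
Implicit Types (G : graph V) (Gam : sgraph V) (s : V -> bool).

Definition sigma Gam (u v : V) : int := (-1) ^+ neg Gam u v.

(* [c] lists the vertices of a cycle in cyclic order, without repetition. *)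
Definition balanced Gam : Prop :=
  forall c : seq V, (2 < size c)%N -> ucycle (edge Gam) c ->
    \prod_(u <- c) sigma Gam u (next c u) = 1.

Definition unsigned G : sgraph V :=
  @SGraph V G (fun _ _ => false) (fun _ _ => erefl).

Definition compl_edge G : rel V := fun u v => (u != v) && ~~ edge G u v.

Lemma compl_edge_sym G : symmetric (compl_edge G).
Proof. by move=> u v; rewrite /compl_edge eq_sym edge_sym. Qed.

Lemma compl_edge_irr G : irreflexive (compl_edge G).
Proof. by move=> u; rewrite /compl_edge eqxx. Qed.

Definition compl_graph G : graph V :=
  Graph (compl_edge_sym G) (compl_edge_irr G).

Definition complete_edge : rel V := fun u v => u != v.

Lemma complete_edge_sym : symmetric complete_edge.
Proof. by move=> u v; rewrite /complete_edge eq_sym. Qed.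

Lemma complete_edge_irr : irreflexive complete_edge.
Proof. by move=> u; rewrite /complete_edge eqxx. Qed.

Definition complete_graph : graph V :=
  Graph complete_edge_sym complete_edge_irr.

Definition degree G (u : V) : nat := #|[set v | edge G u v]|.

(* Row and column i of these matrices stand for the vertex [enum_val i]. *)
Definition adjmx (R : pzRingType) Gam : 'M[R]_#|V| :=
  \matrix_(i, j) if edge Gam (enum_val i) (enum_val j)
                 then (sigma Gam (enum_val i) (enum_val j))%:~R else 0.

Definition degmx (R : pzRingType) G : 'M[R]_#|V| :=
  diag_mx (\row_i (degree G (enum_val i))%:R).

Definition laplacian (R : pzRingType) Gam : 'M[R]_#|V| :=
  degmx R Gam - adjmx R Gam.

(* Every diagonal matrix with diagonal entries 1 and -1 is [switch_mx s] for
   some [s]. *)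
Definition switch_mx (R : pzRingType) s : 'M[R]_#|V| :=
  diag_mx (\row_i (-1) ^+ s (enum_val i)).

Definition compl_neg s (u v : V) : bool := s u (+) s v.

Lemma compl_neg_sym s u v : compl_neg s u v = compl_neg s v u.
Proof. by rewrite /compl_neg addbC. Qed.

(* The signed complement depends on the choice of S = [switch_mx s]; see
   [adjmx_signed_compl] and [laplacian_signed_compl] for its matrices. *)
Definition signed_compl G s : sgraph V :=
  @SGraph V (compl_graph G) (compl_neg s) (compl_neg_sym s).

Lemma mul_switch_mxE (R : pzRingType) s (M : 'M[R]_#|V|) i j :
  (switch_mx R s *m M *m switch_mx R s) i j =
  (-1) ^+ s (enum_val i) * M i j * (-1) ^+ s (enum_val j).
Proof. by rewrite /switch_mx mul_mx_diag mxE mul_diag_mx !mxE. Qed.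

Lemma adjmx_signed_compl (R : comPzRingType) G s :
  adjmx R (signed_compl G s) =
  switch_mx R s *m adjmx R (unsigned (compl_graph G)) *m switch_mx R s.
Proof.
apply/matrixP=> i j; rewrite mul_switch_mxE !mxE /=.
case: ifP => _; last by rewrite mulr0 mul0r.
by rewrite /sigma /= mulr1 -signr_addb rmorph_sign.
Qed.

Lemma laplacian_signed_compl (R : comPzRingType) G s :
  laplacian R (signed_compl G s) =
  switch_mx R s *m laplacian R (unsigned (compl_graph G)) *m switch_mx R s.
Proof.
rewrite /laplacian mulmxBr mulmxBl -adjmx_signed_compl; congr (_ - _).
apply/matrixP=> i j; rewrite mul_switch_mxE !mxE.
have [->|_] := eqVneq i j; last by rewrite !mulr0n mulr0 mul0r.
by rewrite mulr1n mulrAC -signr_addb addbb mul1r.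
Qed.

End Graphs.

(* Switching: a balanced signature has the form [compl_neg s] on the edges. *)
Section Switching.
Variables (V : finType) (Gam : sgraph V).
Let e : rel V := edge Gam.

Fixpoint walk_neg (x : V) (p : seq V) : bool :=
  if p is y :: q then neg Gam x y (+) walk_neg y q else false.

Lemma walk_neg_cat x p q :
  walk_neg x (p ++ q) = walk_neg x p (+) walk_neg (last x p) q.
Proof. by elim: p x => //= y p IH x; rewrite IH addbA. Qed.

Lemma walk_neg_sign x p :
  \prod_(i < size p) sigma Gam (nth x (x :: p) i) (nth x p i) =
  (-1) ^+ walk_neg x p.
Proof.
elim: p x => [|y p IH] x; first by rewrite big_ord0.
rewrite /= big_ord_recl /= signr_addb -IH; congr (_ * _).
apply: eq_bigr => i _; have hi := ltn_ord i.
by congr (sigma _ _ _); apply: set_nth_default => //=; exact: ltnW.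
Qed.

Lemma cycle_neg_sign y q :
  uniq (y :: q) ->
  \prod_(u <- y :: q) sigma Gam u (next (y :: q) u) =
  (-1) ^+ walk_neg y (rcons q y).
Proof.
move=> uq; rewrite -walk_neg_sign (big_nth y) big_mkord size_rcons.
apply: eq_bigr => i _; have hi := ltn_ord i.
rewrite next_nth mem_nth // index_uniq //; congr (sigma _ _ _).
  by case: (val i) hi => //= j hj; rewrite nth_rcons; rewrite ltnS in hj; rewrite hj.
rewrite nth_rcons; case: ltnP => // hq.
have -> : val i = size q by apply/eqP; rewrite eqn_leq hq andbT -ltnS.
by rewrite eqxx nth_default.
Qed.

Hypothesis hbal : balanced Gam.

Lemma closed_walk_neg x p : path e x p -> last x p = x -> walk_neg x p = false.
Proof.
have [m] := ubnP (size p); elim: m x p => // m IH x p hm ep lp.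
case: (boolP (uniq p)) => [up|/(uniqPn x)[i [j [hij hj E]]]].
  case/lastP: p hm ep lp up => // q z hm ep; rewrite last_rcons => zx; subst z.
  rewrite rcons_uniq => /andP[xq uq].
  have ux : uniq (x :: q) by rewrite /= xq.
  case: q ux {uq xq} hm ep => [|y [|z q]] ux hm ep.
  - by move: ep; rewrite /= /e edge_irr.
  - by rewrite /= (neg_sym Gam y x) addbF addbb.
  have := hbal (c := [:: x, y, z & q]) isT.
  rewrite cycle_neg_sign // => /(_ _); case: (walk_neg _ _) => //.
  by rewrite expr1 => h; suff /h : ucycle e [:: x, y, z & q] by []; apply/andP.
have hi : (i < size p)%N := ltn_trans hij hj.
set a := nth x p i in E *.
pose p1 := take i.+1 p; pose p2 := drop i.+1 (take j.+1 p); pose p3 := drop j.+1 p.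
have p1E : take i.+1 (take j.+1 p) = p1 by rewrite take_takel // ltnW.
have pE : p = p1 ++ p2 ++ p3 by rewrite catA -p1E cat_take_drop cat_take_drop.
have l1 : last x p1 = a by rewrite /p1 (take_nth x) // last_rcons.
have l12 : last x (p1 ++ p2) = a.
  by rewrite -p1E cat_take_drop (take_nth x) // last_rcons E.
have l2 : last a p2 = a by rewrite -[RHS]l12 last_cat l1.
have s1 : size p1 = i.+1 by rewrite size_takel.
have s2 : (0 < size p2)%N by rewrite size_drop size_takel // subn_gt0 ltnS.
move: ep lp hm; rewrite pE !cat_path !last_cat !walk_neg_cat !size_cat l1 l2.
move=> /and3P[ep1 ep2 ep3] lp hm.
rewrite (IH a p2) //; last first.
  by move: hm; rewrite s1; clear; lia.
rewrite addFb -l1 -walk_neg_cat; apply: IH.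
- by move: hm s2; rewrite size_cat; clear; lia.
- by rewrite cat_path ep1 l1.
- by rewrite last_cat l1.
Qed.

Lemma balanced_switching (R : pzRingType) :
  exists s, adjmx R Gam =
            switch_mx R s *m adjmx R (unsigned Gam) *m switch_mx R s.
Proof.
have sym : connect_sym e by apply: sym_connect_sym => u v; exact: edge_sym.
have walk v : exists p,
      path e (fingraph.root e v) p && (last (fingraph.root e v) p == v).
  have /connectP[p ep lp] : connect e (fingraph.root e v) v by rewrite sym connect_root.
  by exists p; rewrite ep -lp eqxx.
pose w v := xchoose (walk v); pose s v := walk_neg (fingraph.root e v) (w v).
have wP v : path e (fingraph.root e v) (w v) /\ last (fingraph.root e v) (w v) = v.
  by have /andP[? /eqP] := xchooseP (walk v).
have sP u v : edge Gam u v -> neg Gam u v = s u (+) s v.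
  move=> uv; have [pu lu] := wP u; have [pv lv] := wP v.
  have /connectP[q eq lq] : connect e v (fingraph.root e v) by rewrite connect_root.
  have ruv : fingraph.root e u = fingraph.root e v by apply/(fingraph.rootP sym); exact: connect1.
  have h1 : walk_neg (fingraph.root e v) (w v ++ q) = false.
    by apply: closed_walk_neg; rewrite ?cat_path ?last_cat lv ?pv.
  have h2 : walk_neg (fingraph.root e u) (w u ++ v :: q) = false.
    by apply: closed_walk_neg; rewrite ?cat_path ?last_cat lu ?pu ?ruv //=; apply/andP.
  move: h1 h2; rewrite !walk_neg_cat lu lv /= -/(s u) -/(s v).
  by case: (s u); case: (s v); case: (neg _ _ _); case: (walk_neg _ _).
exists s; apply/matrixP=> i j; rewrite mul_switch_mxE !mxE /=.
case: ifP => [/sP h|_]; last by rewrite mulr0 mul0r.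
by rewrite /sigma /= mulr1 -signr_addb rmorph_sign h.
Qed.

End Switching.

Notation ksubset V k := {A : {set V} | #|A| == k}.

Section Token.
Variables (V : finType) (k : nat).

Definition symdiff (A B : {set V}) : {set V} := (A :\: B) :|: (B :\: A).

Lemma symdiffC A B : symdiff A B = symdiff B A.
Proof. by rewrite /symdiff setUC. Qed.

Definition token_move (G : graph V) (A B : {set V}) (a b : V) : bool :=
  [&& a \in A, b \in B, edge G a b & symdiff A B == [set a; b]].

Lemma token_moveC G A B a b : token_move G A B a b = token_move G B A b a.
Proof.
by rewrite /token_move symdiffC edge_sym setUC andbCA; do !congr (_ && _).
Qed.

(* At most one pair (a, b) satisfies [token_move G A B a b]. *)
Definition token_edge (G : graph V) : rel (ksubset V k) := fun A B =>
  [exists a, exists b, token_move G (val A) (val B) a b].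

Definition token_neg (Gam : sgraph V) (A B : ksubset V k) : bool :=
  [exists a, exists b, token_move Gam (val A) (val B) a b && neg Gam a b].

Lemma token_edge_sym G : symmetric (token_edge G).
Proof.
move=> A B; apply/existsP/existsP=> -[a /existsP[b h]];
  by exists b; apply/existsP; exists a; rewrite token_moveC.
Qed.

Lemma token_edge_irr G : irreflexive (token_edge G).
Proof.
move=> A; apply/existsP=> -[a /existsP[b /and4P[_ _ _ /eqP h]]].
by have := set21 a b; rewrite -h /symdiff setDv setU0 inE.
Qed.

Lemma token_neg_sym Gam A B : token_neg Gam A B = token_neg Gam B A.
Proof.
apply/existsP/existsP=> -[a /existsP[b h]];
  by exists b; apply/existsP; exists a; rewrite token_moveC neg_sym.
Qed.

Definition token_base (G : graph V) : graph (ksubset V k) :=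
  Graph (token_edge_sym G) (token_edge_irr G).

Definition token_graph (Gam : sgraph V) : sgraph (ksubset V k) :=
  @SGraph _ (token_base Gam) (token_neg Gam) (token_neg_sym Gam).

Lemma token_move_inj G A B a b a' b' :
  token_move G A B a b -> token_move G A B a' b' -> a = a' /\ b = b'.
Proof.
move=> /and4P[aA bB eab /eqP h] /and4P[a'A b'B eab' /eqP h'].
have nab x y : edge G x y -> x != y.
  by move=> e; apply: contraTneq e => ->; rewrite edge_irr.
have ab := nab _ _ eab; have ab' := nab _ _ eab'.
have ha : (a \in [set a'; b']) by rewrite -h' h set21.
have hb : (b \in [set a'; b']) by rewrite -h' h set22.
have : a \in symdiff A B by rewrite h set21.
rewrite !inE aA /= orbF andbT => aB.
have : b \in symdiff A B by rewrite h set22.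
rewrite !inE bB /= andbT => bA.
split.
  by case/set2P: ha => // E; rewrite E b'B in aB.
by case/set2P: hb => // E; rewrite E a'A in bA.
Qed.

Lemma sigma_token_graph (Gam : sgraph V) (A B : ksubset V k) a b :
  token_move Gam (val A) (val B) a b ->
  sigma (token_graph Gam) A B = sigma Gam a b.
Proof.
move=> h; rewrite /sigma /=; congr ((-1) ^+ nat_of_bool _).
apply/existsP/idP=> [[a' /existsP[b' /andP[h' n]]]|n].
  by have [-> ->] := token_move_inj h h'.
by exists a; apply/existsP; exists b; rewrite h.
Qed.

Lemma card_ksubset : #|{: ksubset V k}| = 'C(#|V|, k).
Proof.
by rewrite card_sub -(card_draws V k) cardsE; apply: eq_card => A; rewrite !inE.
Qed.

End Token.

(* [a] lists the eigenvalues of [M] with (algebraic) multiplicities. *)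
Definition eigenvalue_list (R : comNzRingType) (m N : nat) (M : 'M[R]_m)
    (a : 'I_N -> R) : Prop :=
  char_poly M = \prod_(i < N) ('X - (a i)%:P).

(* Main.v *)
Require Import Defs.
From mathcomp Require Import all_boot all_order all_fingroup all_algebra.
From mathcomp Require Import complex.
Set Implicit Arguments. Unset Strict Implicit. Unset Printing Implicit Defensive.
Import Order.TTheory GRing.Theory Num.Theory.
Local Open Scope ring_scope.

(** Switching by T = diag(prod_(x in A) s x) turns the Laplacian of F_k(Gamma)
    into T L T and that of F_k of the signed complement into T L' T, with L and
    L' the Laplacians of F_k(G) and F_k(complement of G). Since L + L' is the
    Laplacian J of the Johnson graph, everything reduces to L commuting with J.
    Now L is the sum over the edges ab of 1 - P_(a b), where P_(a b) permutes
    the k-subsets by the transposition (a b); J is the same sum over all pairs,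
    hence commutes with every P_(a b). Commuting real symmetric matrices are
    unitarily cotrigonalizable over R[i], and the diagonal entries of the two
    triangular forms are real and add up entrywise. *)

(** * Similarity invariance and simultaneous triangularization *)

Lemma char_poly_conj (R : comNzRingType) m (P Q A : 'M[R]_m) :
  P *m Q = 1%:M -> char_poly (P *m A *m Q) = char_poly A.
Proof.
move=> PQ1; pose f := map_mx (@polyC R) : 'M_m -> 'M_m.
have fPQ : f P *m f Q = 1%:M by rewrite /f -map_mxM PQ1 map_mx1.
have -> : char_poly (P *m A *m Q) = \det (f P *m char_poly_mx A *m f Q).
  congr (\det _); rewrite /char_poly_mx mulmxBr mulmxBl -!map_mxM.
  by rewrite mul_mx_scalar -scalemxAl fPQ scalemx1.
by rewrite !det_mulmx mulrAC -det_mulmx fPQ det1 mul1r.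
Qed.

Lemma char_poly_conjmx (F : fieldType) m (P A : 'M[F]_m) :
  P \in unitmx -> char_poly (conjmx P A) = char_poly A.
Proof. by move=> Pu; rewrite conjumx // (char_poly_conj _ (mulmxV Pu)). Qed.

Lemma eigenvalue_list_trig (F : fieldType) m (P A : 'M[F]_m) :
  P \in unitmx -> is_trig_mx (conjmx P A) ->
  eigenvalue_list A (fun j => conjmx P A j j).
Proof.
move=> Pu TA.
by rewrite /eigenvalue_list -(char_poly_conjmx A Pu) char_poly_trig.
Qed.

(** For unitary [P] the inverse in [conjmx P A] is the conjugate transpose, so the conjugate is
    again Hermitian. *)
Lemma conjmx_hermitian_diag_real (C : numClosedFieldType) m (A P : 'M[C]_m) j :
  map_mx Num.conj A^T = A -> P \is unitarymx -> conjmx P A j j \is Num.real.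
Proof.
move=> hA uP; rewrite conjymx //; set M := P *m _ *m _.
rewrite CrealE; apply/eqP.
suff /matrixP/(_ j j) : map_mx Num.conj M^T = M by rewrite 2!mxE.
by rewrite /M !trmx_mul !map_mxM trmxCK hA mulmxA.
Qed.

Lemma commuting_hermitian_eigenvalues (C : numClosedFieldType) m
    (A B : 'M[C]_m) :
  map_mx Num.conj A^T = A -> map_mx Num.conj B^T = B -> A *m B = B *m A ->
  exists a b : 'I_m -> C,
    [/\ forall j, a j \is Num.real /\ b j \is Num.real,
        eigenvalue_list A a, eigenvalue_list B b
      & eigenvalue_list (A + B) (fun j => a j + b j)].
Proof.
move=> hA hB /cotrigonalization2[P uP /andP[TA TB]].
have Pu := unitarymx_unit uP.
exists (fun j => conjmx P A j j), (fun j => conjmx P B j j); split.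
- by move=> j; split; apply: conjmx_hermitian_diag_real.
- exact: eigenvalue_list_trig.
- exact: eigenvalue_list_trig.
have addE : conjmx P (A + B) = conjmx P A + conjmx P B.
  by rewrite /conjmx mulmxDr mulmxDl.
rewrite /eigenvalue_list (eigenvalue_list_trig Pu).
  by apply: eq_bigr => j _; rewrite addE mxE.
rewrite addE; apply/is_trig_mxP => u v uv; rewrite mxE.
have [/is_trig_mxP tA /is_trig_mxP tB] := (TA, TB).
by rewrite tA // tB // addr0.
Qed.

Lemma eigenvalue_list_map (F K : fieldType) (f : {rmorphism F -> K}) m N
    (A : 'M[F]_m) (a : 'I_N -> F) :
  eigenvalue_list (map_mx f A) (f \o a) -> eigenvalue_list A a.
Proof.
rewrite /eigenvalue_list -map_char_poly => E.
apply: (map_poly_inj f); rewrite E rmorph_prod; apply: eq_bigr => j _.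
by rewrite rmorphB /= map_polyX map_polyC.
Qed.

(** The separate size [N] lets the lists be indexed by a binomial coefficient, which equals the
    matrix size only propositionally. *)
Lemma commuting_symmetric_eigenvalues (R : rcfType) m N (A B : 'M[R]_m) :
  m = N -> A^T = A -> B^T = B -> A *m B = B *m A ->
  exists a b : 'I_N -> R, [/\ eigenvalue_list A a, eigenvalue_list B b
    & eigenvalue_list (A + B) (fun j => a j + b j)].
Proof.
move=> <- symA symB AB; pose f : {rmorphism R -> R[i]} := real_complex R.
have herm (M : 'M[R]_m) :
    M^T = M -> map_mx Num.conj (map_mx f M)^T = map_mx f M.
  move=> symM; apply/matrixP=> u v; rewrite !mxE -[in RHS]symM mxE.
  exact: conjc_real.
have ABC : map_mx f A *m map_mx f B = map_mx f B *m map_mx f A.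
  by rewrite -!map_mxM AB.
have [a [b [rab EA EB EAB]]] :=
  commuting_hermitian_eigenvalues (herm A symA) (herm B symB) ABC.
(* The eigenvalues found over [R[i]] are real, so their real parts list them over [R]. *)
have ra j : f (complex.Re (a j)) = a j by apply: RRe_real; case: (rab j).
have rb j : f (complex.Re (b j)) = b j by apply: RRe_real; case: (rab j).
exists (fun j => complex.Re (a j)), (fun j => complex.Re (b j)).
split; apply: (eigenvalue_list_map (f := f)); rewrite /eigenvalue_list.
- by rewrite EA; apply: eq_bigr => j _; rewrite [(f \o _) j]ra.
- by rewrite EB; apply: eq_bigr => j _; rewrite [(f \o _) j]rb.
rewrite map_mxD EAB; apply: eq_bigr => j _; congr ('X - _%:P).
by rewrite -[in LHS]ra -[in LHS]rb -rmorphD.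
Qed.

(** * Token moves as transpositions *)

Section TokenTransposition.
Variable V : finType.
Implicit Types (G : graph V) (A B : {set V}).

Lemma in_symdiff A B x : (x \in symdiff A B) = (x \in A) (+) (x \in B).
Proof. by rewrite !inE; do 2!case: (x \in _). Qed.

Lemma in_tperm_imset A a b x : (x \in tperm a b @: A) = (tperm a b x \in A).
Proof. by rewrite -{1}[x](tpermK a b) mem_imset //; apply: perm_inj. Qed.

Lemma token_moveE G A B a b :
  token_move G A B a b =
  [&& edge G a b, a \in A, b \notin A & tperm a b @: A == B].
Proof.
apply/and4P/and4P => [[aA bB eab /eqP D]|[eab aA bA /eqP <-]].
  have Dx x : (x \in B) = (x \in A) (+) (x \in [set a; b]).
    by rewrite -D in_symdiff addKb.
  have bA : b \notin A by move: bB; rewrite Dx set22 addbT.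
  split=> //; apply/eqP/setP => x; rewrite in_tperm_imset Dx !inE.
  case: tpermP => [->|->|/eqP/negPf-> /eqP/negPf->]; last by rewrite addbF.
  - by rewrite eqxx aA (negPf bA).
  - by rewrite eqxx orbT aA (negPf bA).
rewrite in_tperm_imset tpermR; split=> //.
apply/eqP/setP => x; rewrite in_symdiff in_tperm_imset !inE.
case: tpermP => [->|->|/eqP/negPf-> /eqP/negPf->]; last by rewrite addbb.
- by rewrite eqxx aA (negPf bA).
- by rewrite eqxx orbT aA (negPf bA).
Qed.

(** A transposition fixes every set that contains both or neither of [a] and [b]. As [A != B],
    exactly one of them lies in [A], and it determines the direction of the move. *)
Lemma tperm_imset_moves G A B a b : A != B ->
  edge G a b && (tperm a b @: A == B) =
  token_move G A B a b || token_move G A B b a.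
Proof.
move=> AB; rewrite !token_moveE [edge G b a]edge_sym [tperm b a]tpermC.
have [eab|//] := boolP (edge G a b).
have [tA|] := eqVneq (tperm a b @: A) B; last by rewrite !andbF.
rewrite !andbT /=; have [aA|aA] := boolP (a \in A);
  have [bA|bA] := boolP (b \in A) => //=;
  case/eqP: AB; rewrite -tA; apply/setP => x; rewrite in_tperm_imset;
  by case: tpermP => [->|->|]; rewrite ?aA ?bA ?(negPf aA) ?(negPf bA).
Qed.

(** The factor 2 arises because pairs are ordered: the unique move from [A] to [B] along [ab] is
    counted as [(a, b)] and as [(b, a)]. *)
Lemma card_tperm_moves k G (A B : ksubset V k) : A != B ->
  #|[pred u : V * V | edge G u.1 u.2 && (tperm u.1 u.2 @: val A == val B)]| =
  (token_edge G A B).*2.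
Proof.
move=> AB; have vAB : val A != val B by apply: contraNneq AB => /val_inj->.
have [/existsP[a /existsP[b ab]]|nAB] := boolP (token_edge G A B).
  have nab : a != b.
    case/and4P: ab => _ _ eab _; apply: contraTneq eab => ->.
    by rewrite edge_irr.
  rewrite -[RHS](_ : #|[set (a, b); (b, a)]| = _); last first.
    by rewrite cards2 xpair_eqE negb_and nab.
  apply: eq_card => -[c d]; rewrite !inE /= tperm_imset_moves // !xpair_eqE.
  apply/orP/orP => -[h|h].
  - by have [-> ->] := token_move_inj h ab; rewrite !eqxx; left.
  - by have [-> ->] := token_move_inj h ab; rewrite !eqxx; right.
  - by case/andP: h => /eqP-> /eqP->; left.
  - by case/andP: h => /eqP-> /eqP->; right.
apply: eq_card0 => -[c d]; rewrite !inE /= tperm_imset_moves //.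
apply: contraNF nAB => /orP[] h.
  by apply/existsP; exists c; apply/existsP; exists d.
by apply/existsP; exists d; apply/existsP; exists c.
Qed.

End TokenTransposition.

(** * Permutation matrices on the k-subsets *)

Section SubsetAction.
Variables (R : comNzRingType) (V : finType) (k : nat).
Implicit Types (G : graph V) (p q : {perm V}).
Local Notation W := (ksubset V k).

Lemma card_perm_imset p (A : W) : #|p @: val A| == k.
Proof. by rewrite card_imset ?(valP A) //; apply: perm_inj. Qed.

Definition perm_ksubset p (A : W) : W := Sub (p @: val A) (card_perm_imset p A).

Definition ksubset_mx p : 'M[R]_#|{: W}| :=
  \matrix_(i, j) (perm_ksubset p (enum_val i) == enum_val j)%:R.

Lemma sum_pred1_enum (T : finType) (x : T) (F : 'I_#|T| -> R) :
  \sum_j (x == enum_val j)%:R * F j = F (enum_rank x).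
Proof.
rewrite (bigD1 (enum_rank x)) //= enum_rankK eqxx mul1r big1 ?addr0 // => j jx.
by rewrite -(inj_eq enum_rank_inj) enum_valK eq_sym (negPf jx) mul0r.
Qed.

(** Row A has its 1 in column p(A), which fits the left-to-right product of permutations, so the
    order of the factors is kept. *)
Lemma ksubset_mxM p q : ksubset_mx p *m ksubset_mx q = ksubset_mx (p * q).
Proof.
apply/matrixP => i j; rewrite !mxE; under eq_bigr do rewrite !mxE.
rewrite sum_pred1_enum enum_rankK; congr ((_ == _)%:R); apply: val_inj => /=.
by rewrite -imset_comp; apply: eq_imset => x; rewrite permM.
Qed.

(** Each edge of [G] occurs as two ordered pairs, hence the doubling. Off the diagonal this is
    [card_tperm_moves]; on the diagonal, the transpositions that move A are counted by their
    images. *)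
Lemma double_token_laplacian G :
  laplacian R (unsigned (token_base k G)) *+ 2 =
  \sum_(u : V * V | edge G u.1 u.2) (1%:M - ksubset_mx (tperm u.1 u.2)).
Proof.
have moves (A B : W) : A != B ->
    \sum_(u : V * V | edge G u.1 u.2)
      (perm_ksubset (tperm u.1 u.2) A == B)%:R
    = (token_edge G A B)%:R *+ 2 :> R.
  move=> AB; rewrite -mulrnA muln2 -card_tperm_moves // -sum1_card natr_sum.
  rewrite [RHS]big_mkcondr /=; apply: eq_bigr => u _.
  by rewrite -val_eqE /=; case: eqP.
apply/matrixP => i j; rewrite !mxE summxE.
rewrite /degree /sigma /= expr0; set A := enum_val i.
have [<-|ij] := eqVneq i j; last first.
  have AB : A != enum_val j by rewrite (inj_eq enum_val_inj).
  under eq_bigr do rewrite !mxE (negPf ij) sub0r.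
  rewrite sumrN moves // mulr0n sub0r mulr2n opprD.
  by case: (token_edge _ _ _).
rewrite -/A token_edge_irr subr0 mulr1n -mulr2n.
under eq_bigr do rewrite !mxE eqxx -/A.
(* The summand 1 - [tA = A] is rewritten as the sum of [tA = B] over B other than A, and the two
   sums are exchanged. *)
transitivity (\sum_(B : W | B != A) \sum_(u : V * V | edge G u.1 u.2)
    (perm_ksubset (tperm u.1 u.2) A == B)%:R : R).
  rewrite (eq_bigr (fun B => (token_edge G A B)%:R *+ 2)); last first.
    by move=> B BA; rewrite moves // eq_sym.
  rewrite sumrMnl.
  rewrite -sum1_card natr_sum big_mkcond [in RHS]big_mkcond; congr (_ *+ 2).
  apply: eq_bigr => B _; rewrite inE; have [->|_] := eqVneq B A.
    by rewrite token_edge_irr.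
  by case: (token_edge G A B).
rewrite exchange_big; apply: eq_bigr => u _ /=; set C := perm_ksubset _ _.
have [->|CA] := eqVneq C A.
  by rewrite subrr big1 // => B BA; rewrite eq_sym (negPf BA).
rewrite subr0 (bigD1 C) //= eqxx big1 ?addr0 // => B /andP[_ BC].
by rewrite eq_sym (negPf BC).
Qed.

End SubsetAction.

(** * Token Laplacians under complement, permutation and switching *)

Lemma trmx_laplacian (R : pzRingType) (V : finType) (Gam : sgraph V) :
  (laplacian R Gam)^T = laplacian R Gam.
Proof.
apply/matrixP => i j; rewrite !mxE edge_sym /sigma neg_sym.
by have [->|ij] := eqVneq i j; rewrite // !mulr0n.
Qed.

Lemma switch_mxK (R : pzRingType) (V : finType) (s : V -> bool) :
  switch_mx R s *m switch_mx R s = 1%:M :> 'M_#|V|.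
Proof.
apply/matrixP => i j; rewrite /switch_mx mul_diag_mx !mxE.
by case: eqVneq => [->|_]; rewrite ?mulr0n ?mulr0 // mulr1n -signr_addb addbb.
Qed.

Section TokenLaplacian.
Variables (R : numFieldType) (V : finType) (k : nat).
Implicit Types (G : graph V) (Gam : sgraph V).
Local Notation token_lap G := (laplacian R (unsigned (token_base k G))).
Local Notation johnson_lap := (token_lap (complete_graph V)).

Lemma mulmx2n_inj m n (A B : 'M[R]_(m, n)) : A *+ 2 = B *+ 2 -> A = B.
Proof. by rewrite -2!scaler_nat; apply: scalerI; rewrite pnatr_eq0. Qed.

Lemma token_laplacian_compl G :
  token_lap G + token_lap (compl_graph G) = johnson_lap.
Proof.
apply: mulmx2n_inj; rewrite mulrnDl !double_token_laplacian.
rewrite [RHS](bigID (fun u => edge G u.1 u.2)) /=.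
congr (_ + _); apply: eq_bigl => -[a b] //=; rewrite /complete_edge.
by case: eqVneq => [->|]; rewrite ?edge_irr.
Qed.

(** Conjugation by [p] turns (a b) into (p a, p b), and this only permutes the pairs of distinct
    vertices over which the sum runs. *)
Lemma johnson_laplacian_comm_perm (p : {perm V}) :
  johnson_lap *m ksubset_mx R k p = ksubset_mx R k p *m johnson_lap.
Proof.
apply: mulmx2n_inj; rewrite !mulr2n -mulmxDl -mulmxDr -!mulr2n.
rewrite double_token_laplacian mulmx_suml mulmx_sumr.
rewrite [RHS](reindex (fun u => (p u.1, p u.2))) /=.
  apply: eq_big => [u|u _]; first by rewrite /complete_edge (inj_eq perm_inj).
  rewrite mulmxBl mulmxBr mul1mx mulmx1 !ksubset_mxM -tpermJ.
  by rewrite conjgC.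
exists (fun u => (p^-1%g u.1, p^-1%g u.2)) => -[a b] _ /=.
  by rewrite !permK.
by rewrite !permKV.
Qed.

Lemma johnson_laplacian_comm G :
  token_lap G *m johnson_lap = johnson_lap *m token_lap G.
Proof.
apply: mulmx2n_inj; rewrite !mulr2n -mulmxDl -mulmxDr -!mulr2n.
rewrite double_token_laplacian mulmx_suml mulmx_sumr; apply: eq_bigr => u _.
by rewrite [LHS]mulmxBl [RHS]mulmxBr mul1mx mulmx1 johnson_laplacian_comm_perm.
Qed.

(** Parity form of the product of the signs of the elements of [A]. *)
Definition token_switch (s : V -> bool) (A : ksubset V k) : bool :=
  \big[addb/false]_(x in val A) s x.

(** [A] and [B] share all elements but [a] and [b], and the common part cancels modulo 2. *)
Lemma token_switch_move G s (A B : ksubset V k) a b :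
  token_move G (val A) (val B) a b ->
  token_switch s A (+) token_switch s B = s a (+) s b.
Proof.
rewrite token_moveE /token_switch => /and4P[_ aA bA /eqP <-].
have tAb : b \in tperm a b @: val A by rewrite in_tperm_imset tpermR.
rewrite (big_setD1 a aA) (big_setD1 b tAb) /=.
have -> : (tperm a b @: val A) :\ b = val A :\ a.
  apply/setP => x; rewrite !inE in_tperm_imset.
  case: tpermP => [->|->|/eqP/negPf-> /eqP/negPf-> //].
    by rewrite eqxx (negPf bA) andbF.
  by rewrite eqxx (negPf bA) andbF.
by rewrite addbACA addbb addbF.
Qed.

(** Off the diagonal this is [token_switch_move]; diagonal entries survive because signs square to
    1. It serves for [Gam], for its signed complement, and for the complete graph with constant
    [s]. *)
Lemma laplacian_token_graph_switch Gam s :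
  (forall u v, edge Gam u v -> neg Gam u v = s u (+) s v) ->
  laplacian R (token_graph k Gam) =
  switch_mx R (token_switch s) *m token_lap Gam *m switch_mx R (token_switch s).
Proof.
move=> negE; apply/matrixP => i j; rewrite mul_switch_mxE !mxE /=.
have [<-|ij] := eqVneq i j.
  by rewrite token_edge_irr !subr0 mulrAC -signr_addb addbb mul1r.
rewrite !mulr0n !sub0r mulrN mulNr; congr (- _).
case: ifP => [/existsP[a /existsP[b ab]]|_]; last by rewrite mulr0 mul0r.
rewrite (sigma_token_graph ab) /sigma /= negE; last by case/and4P: ab.
by rewrite mulr1 -signr_addb (token_switch_move s ab) rmorph_sign.
Qed.

(** Entrywise comparison recovers the parities, since 1 and -1 differ in characteristic 0. *)
Lemma switching_neg Gam s :
  adjmx R Gam = switch_mx R s *m adjmx R (unsigned Gam) *m switch_mx R s ->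
  forall u v, edge Gam u v -> neg Gam u v = s u (+) s v.
Proof.
move=> /matrixP E u v uv; have := E (enum_rank u) (enum_rank v).
rewrite mul_switch_mxE !mxE /= !enum_rankK uv /sigma /= mulr1 -signr_addb.
rewrite rmorph_sign; case: (neg _ _ _); case: (_ (+) _) => // /eqP.
  by rewrite expr1 expr0 eq_sym -subr_eq0 opprK -mulr2n pnatr_eq0.
by rewrite expr1 expr0 -subr_eq0 opprK -mulr2n pnatr_eq0.
Qed.

End TokenLaplacian.

Theorem theorem7p3 (R : rcfType) (n k : nat) (V : finType) (hV : #|V| = n)
    (Gam : sgraph V) (hbal : balanced Gam) (hk : (1 <= k <= n - 1)%N)
    (s : V -> bool)
    (hs : adjmx R Gam = switch_mx R s *m adjmx R (unsigned Gam) *m switch_mx R s) :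
  let Lk : 'M[R]_#|{: ksubset V k}| := laplacian R (token_graph k Gam) in
  let Lkbar : 'M[R]_#|{: ksubset V k}| :=
    laplacian R (token_graph k (signed_compl Gam s)) in
  let LJ : 'M[R]_#|{: ksubset V k}| :=
    laplacian R (token_graph k (unsigned (complete_graph V))) in
  Lk *m Lkbar = Lkbar *m Lk /\
  exists alpha beta gamma : 'I_('C(n, k)) -> R,
    [/\ eigenvalue_list Lk alpha,
        eigenvalue_list Lkbar beta,
        eigenvalue_list LJ gamma
      & forall i, alpha i + beta i = gamma i].
Proof.
move=> Lk Lkbar LJ; set T := switch_mx R (@token_switch V k s).
pose lap (G : graph V) : 'M[R]_#|{: ksubset V k}| :=
  laplacian R (unsigned (token_base k G)).
pose J := lap (complete_graph V).
have TT : T *m T = 1%:M by exact: switch_mxK.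
have LkE : Lk = T *m lap Gam *m T.
  by apply: laplacian_token_graph_switch; exact: switching_neg hs.
have LkbarE : Lkbar = T *m lap (compl_graph Gam) *m T.
  exact: laplacian_token_graph_switch.
have sumE : Lk + Lkbar = T *m J *m T.
  by rewrite LkE LkbarE -mulmxDl -mulmxDr token_laplacian_compl.
(* Commuting with [Lkbar] amounts to commuting with [Lk + Lkbar], which is [T *m J *m T]. *)
have LkJ : Lk *m (T *m J *m T) = (T *m J *m T) *m Lk.
  have conjM (X Y : 'M_#|{: ksubset V k}|) :
      (T *m X *m T) *m (T *m Y *m T) = T *m (X *m Y) *m T.
    by rewrite !mulmxA -[_ *m T *m T]mulmxA TT mulmx1.
  by rewrite LkE !conjM johnson_laplacian_comm.
have comm : Lk *m Lkbar = Lkbar *m Lk.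
  have -> : Lkbar = T *m J *m T - Lk by rewrite -sumE addrC addKr.
  by rewrite [LHS]mulmxBr [RHS]mulmxBl LkJ.
split=> //.
have cardE : #|{: ksubset V k}| = 'C(n, k) by rewrite card_ksubset hV.
have [a [b [Ea Eb Eab]]] := commuting_symmetric_eigenvalues cardE
  (trmx_laplacian R _) (trmx_laplacian R _) comm.
exists a, b, (fun i => a i + b i); split; [exact: Ea | exact: Eb | | by []].
(* The signature of [LJ] is an existential that is always false, not literally the constant of
   [unsigned]; the trivial switching identifies the two. Thus [LJ] and [Lk + Lkbar] are both similar
   to [J]. *)
have LJE : LJ = switch_mx R (token_switch (fun=> false)) *m J *m
                switch_mx R (token_switch (fun=> false)).
  exact: laplacian_token_graph_switch.
rewrite /eigenvalue_list -Eab sumE LJE.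
by rewrite !char_poly_conj // switch_mxK.
Qed.
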